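(* Let $C\in\mathbb{Z}_{\ge 0}^{n\times n}$ be such that $\langle C,X\rangle$ is not constant over the Birkhoff polytope $B$ of $n\times n$ doubly stochastic matrices, and let $\varepsilon>0$. An additive $\varepsilon$-approximation to the assignment problem with cost matrix $C$ can be found by solving the entropy-penalized version of the assignment problem with parameter $\eta=O\left(n\log\frac n\varepsilon\right)$; that is, for such an $\eta$ the optimal solution $X^\eta$ of the penalized problem satisfies $$\langle C,X^\eta\rangle-\min_{X\in B}\langle C,X\rangle\ \le\ \varepsilon.$$
   Context: The Birkhoff polytope is $B=\{X\in\mathbb{R}^{n\times n}: X\mathbf 1=\mathbf 1,\ X^\top\mathbf 1=\mathbf 1,\ X\ge 0\}$, where $\mathbf 1$ is the all-ones vector, and $\langle C,X\rangle=\sum_{i,j}C_{ij}X_{ij}$. The assignment problem with cost matrix $C$ is the linear program $\min_{X\in B}\langle C,X\rangle$. For nonnegative $X$, $H(X)=\sum_{i,j}X_{ij}\log\frac1{X_{ij}}$ (natural logarithm, $0\log\frac10=0$). The entropy-penalized version with parameter $\eta>0$ is the problem of minimizing $\langle C,X\rangle-\eta^{-1}H(X)$ over $X\in B$, and $X^\eta$ is its (unique) minimizer. The notation $O(\cdot)$ hides an absolute constant, independent of $n$, $C$ and $\varepsilon$.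
   Formalization: The parameter is taken as η = K·n·max(1, log(n/ε)) with an absolute constant K, since n·log(n/ε) is nonpositive for ε ≥ n and tends to 0 as ε approaches n, where the claim fails; for ε ≤ n/e it is exactly K·n·log(n/ε). *)

(* Defs.v *)
From HB Require Import structures.
From mathcomp Require Import all_boot all_order all_algebra.
From mathcomp Require Import all_classical all_reals all_analysis.

Set Implicit Arguments.
Unset Strict Implicit.
Unset Printing Implicit Defensive.

Import Order.TTheory GRing.Theory Num.Theory.

Local Open Scope classical_set_scope.
Local Open Scope ring_scope.

Definition Birkhoff (R : realType) (n : nat) : set 'M[R]_n :=
  [set X | [/\ X *m const_mx 1 = const_mx 1 :> 'cV[R]_n,
               X^T *m const_mx 1 = const_mx 1 :> 'cV[R]_n &
               forall i j, 0 <= X i j]].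
Arguments Birkhoff : clear implicits.

Definition cost (R : realType) (n : nat) (C : 'M[nat]_n) (X : 'M[R]_n) : R :=
  \sum_(i < n) \sum_(j < n) (C i j)%:R * X i j.

(* The term of a zero entry is 0 * ln 0^-1 = 0. *)
Definition entropy (R : realType) (n : nat) (X : 'M[R]_n) : R :=
  \sum_(i < n) \sum_(j < n) X i j * ln (X i j)^-1.

Definition penalized_cost (R : realType) (n : nat) (C : 'M[nat]_n) (eta : R)
    (X : 'M[R]_n) : R :=
  cost C X - eta^-1 * entropy X.

Definition is_minimizer (R : realType) (T : Type) (A : set T) (f : T -> R)
    (x : T) : Prop :=
  A x /\ forall y, A y -> f x <= f y.

(* This infimum is the minimum: [Birkhoff R n] is compact and contains the
   identity matrix, and [cost C] is continuous. *)
Definition assignment_value (R : realType) (n : nat) (C : 'M[nat]_n) : R :=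
  inf [set cost C X | X in Birkhoff R n].

(* Main.v *)
(* By Birkhoff's theorem the penalized minimizer is A + B, where A mixes optimal
   permutation matrices and B suboptimal ones, B having total weight lam. As C
   is integral, the cost gap is lam * D with D >= 1. Comparing with A + lam * P
   for an optimal permutation matrix P, which lowers the entropy by at most
   n * lam * (ln (n / lam) + 1), gives
   eta * D <= n * (ln (n / lam) + 1); hence the gap is at most
   n * D * exp (1 - eta * D / n) <= n * exp (1 - eta / n), and K = 2 works. *)

Require Import Defs.
From HB Require Import structures.
From mathcomp Require Import all_boot all_order all_algebra.
From mathcomp Require Import all_fingroup.
From mathcomp Require Import all_classical all_reals all_analysis.
From mathcomp Require Import zify ring lra.

Set Implicit Arguments.
Unset Strict Implicit.
Unset Printing Implicit Defensive.

Import Order.TTheory GRing.Theory Num.Theory.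

(** * Hall's marriage theorem *)

(** Induction on [#|A|], by cases. If some nonempty proper subset is tight, it and its complement
    are matched separately. Otherwise every such subset has a spare neighbour, and one element can
    be matched freely. [u0] supplies the function when [A] is empty. *)
Lemma hall_marriage (T U : finType) (u0 : U) (e : T -> {set U}) (A : {set T}) :
  (forall S : {set T}, S \subset A -> #|S| <= #|(\bigcup_(x in S) e x)%SET|) ->
  exists f : T -> U,
    {in A &, injective f} /\ (forall x, x \in A -> f x \in e x).
Proof.
have [k] := ubnP #|A|; elim: k e A => // k IHk e A /ltnSE leAk hallA.
have [A0 | [x0 Ax0]] := set_0Vmem A.
  by exists (fun=> u0); split=> x; rewrite A0 inE.
pose N (S : {set T}) := (\bigcup_(x in S) e x)%SET.
have [/existsP[S /and3P[prSA ntS tightS]] | /existsPn slack] :=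
  boolP [exists S : {set T},
    [&& S \proper A, S != (finset.set0 : {set T}) & #|N S| <= #|S|]].
- have sSA := proper_sub prSA.
  have ltSA : #|S| < #|A| by apply: proper_card.
  have S_gt0 : 0 < #|S| by rewrite card_gt0.
  have [|S' sS'S|f [injf fe]] := IHk e S; first exact: leq_trans ltSA leAk.
    by apply: hallA; apply: fintype.subset_trans sSA.
  (* The rest of [A] must avoid [N S]. Hall's condition for [S'] comes from the one for [S :|: S'],
     since [N S] has at most [#|S|] elements. *)
  have [||g [injg ge]] := IHk (fun x => e x :\: N S) (A :\: S).
  + by rewrite cardsDS //; lia.
  + move=> S'; rewrite finset.subsetD => /andP[sS'A disS'].
    have := hallA (S :|: S').
    rewrite finset.subUset sSA sS'A cardsU disjoint_setI0 1?disjoint_sym //.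
    rewrite cards0 subn0 finset.bigcup_setU => /(_ isT).
    have -> : N S :|: (\bigcup_(x in S') e x)%SET =
              N S :|: (\bigcup_(x in S') (e x :\: N S))%SET.
      apply/finset.setP=> y; rewrite !inE; case: (boolP (y \in N S)) => //= yS.
      apply/bigcupP/bigcupP => -[x xS' ye]; exists x => //.
        by rewrite inE yS.
      by move: ye; rewrite inE => /andP[].
    have [+ _] := leq_card_setU (N S) (\bigcup_(x in S') (e x :\: N S))%SET.
    by lia.
  exists (fun x => if x \in S then f x else g x); split=> [x y Ax Ay | x Ax].
  + have fN z : z \in S -> f z \in N S.
      by move=> Sz; apply/bigcupP; exists z; rewrite ?fe.
    have gN z : z \in A -> z \notin S -> g z \notin N S.
      by move=> Az Sz; have := ge z; rewrite !inE Az Sz => /(_ isT) /andP[].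
    case: ifPn => Sx; case: ifPn => Sy.
    * exact: injf.
    * by move=> E; have := gN y Ay Sy; rewrite -E fN.
    * by move=> E; have := gN x Ax Sx; rewrite E fN.
    * by apply: injg; rewrite inE ?Sx ?Sy.
  + case: ifPn => Sx; first exact: fe.
    by have := ge x; rewrite !inE Ax Sx => /(_ isT) /andP[].
- have [y0 ey0] : exists y, y \in e x0.
    have := hallA [set x0]%SET; rewrite finset.sub1set Ax0 cards1.
    by rewrite finset.big_set1 => /(_ isT)/card_gt0P.
  (* Deleting [y0] costs a set at most one neighbour, which [slack] can spare. *)
  have [||f [injf fe]] := IHk (fun x => e x :\ y0) (A :\ x0).
  + by have := cardsD1 x0 A; rewrite Ax0; lia.
  + move=> S; rewrite finset.subsetD1 => /andP[sSA Sx0].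
    have -> : (\bigcup_(x in S) (e x :\ y0))%SET = N S :\ y0.
      apply/finset.setP=> y; rewrite !inE; apply/bigcupP/andP.
        case=> x Sx; rewrite !inE => /andP[-> ey]; split=> //.
        by apply/bigcupP; exists x.
      by case=> ne /bigcupP[x Sx ey]; exists x; rewrite ?inE ?ne.
    have [-> | ntS] := eqVneq S (finset.set0 : {set T}).
      by rewrite cards0.
    have := slack S; rewrite ntS /= fintype.properE sSA /=.
    have -> /= : ~~ (A \subset S) by apply: contra Sx0 => /fintype.subsetP ->.
    by rewrite -ltnNge (cardsD1 y0 (N S)); lia.
  exists (fun x => if x == x0 then y0 else f x); split=> [x y Ax Ay | x Ax].
  + have fy0 z : z \in A -> z != x0 -> f z != y0.
      by move=> Az zx; have := fe z; rewrite !inE Az zx => /(_ isT) /andP[].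
    case: eqP => [->|/eqP xx0]; case: eqP => [->|/eqP yx0] //.
    * by move=> E; have := fy0 y Ay yx0; rewrite -E eqxx.
    * by move=> E; have := fy0 x Ax xx0; rewrite E eqxx.
    * by apply: injf; rewrite !inE ?xx0 ?yx0.
  + case: eqP => [->|/eqP xx0] //.
    by have := fe x; rewrite !inE Ax xx0 => /(_ isT) /andP[].
Qed.

Local Open Scope classical_set_scope.
Local Open Scope ring_scope.

(** * Permutation matrices and Birkhoff's decomposition *)

Lemma perm_mx_entry (R : pzSemiRingType) n (s : 'S_n) (i j : 'I_n) :
  (perm_mx s : 'M[R]_n) i j = (s i == j)%:R.
Proof. by rewrite perm_mxEsub !mxE. Qed.

Lemma perm_mx_row_sum (R : pzSemiRingType) n (s : 'S_n) (i : 'I_n) :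
  \sum_j (perm_mx s : 'M[R]_n) i j = 1.
Proof.
rewrite (bigD1 (s i)) //= perm_mx_entry eqxx big1 ?addr0 // => j ne.
by rewrite perm_mx_entry eq_sym (negPf ne).
Qed.

Lemma perm_mx_col_sum (R : pzSemiRingType) n (s : 'S_n) (j : 'I_n) :
  \sum_i (perm_mx s : 'M[R]_n) i j = 1.
Proof.
rewrite (bigD1 (s^-1 j)%g) //= perm_mx_entry permKV eqxx big1 ?addr0 // => i ne.
by rewrite perm_mx_entry -(inj_eq (@perm_inj _ s^-1%g)) permK (negPf ne).
Qed.

(** Hall's theorem with row [i] adjacent to column [j] when [X i j] is positive: the rows of [S]
    carry mass [t * #|S|], all of it in neighbouring columns, and each column holds only [t]. *)
Lemma perm_in_support (R : realDomainType) n (X : 'M[R]_n) (t : R) :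
  (forall i j, 0 <= X i j) -> (forall i, \sum_j X i j = t) ->
  (forall j, \sum_i X i j = t) -> 0 < t ->
  exists s : 'S_n, forall i, 0 < X i (s i).
Proof.
case: n X => [|n] X X0 rowX colX t0; first by exists 1%g; case.
pose e i := [set j | 0 < X i j]%SET.
have [|f [injf fe]] := @hall_marriage _ _ ord0 e [set: 'I_n.+1]%SET.
  move=> S _; set N := (\bigcup_(_ in _) _)%SET.
  rewrite -(ler_nat R) -(ler_pM2l t0) !mulr_natr -!sumr_const.
  have -> : \sum_(i in S) t = \sum_(i in S) \sum_(j in N) X i j.
    apply: eq_bigr => i Si; rewrite -(rowX i) (bigID (mem N)) /=.
    rewrite [X in _ + X]big1 ?addr0 // => j Nj; apply/eqP.
    rewrite eq_le X0 andbT leNgt; apply: contra Nj => Xij.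
    by apply/bigcupP; exists i; rewrite ?inE.
  rewrite exchange_big /=; apply: ler_sum => j _.
  rewrite -(colX j) [leRHS](bigID (mem S)) /= lerDl.
  by apply: sumr_ge0.
have inj_f : injective f by move=> x y; apply: injf; rewrite inE.
by exists (perm inj_f) => i; have := fe i; rewrite permE !inE => /(_ isT).
Qed.

(* Existence is proved for arbitrary t, not only t = 1, so that a multiple of a
   permutation matrix can be subtracted in the induction. *)
Lemma perm_mx_decomposition (R : realDomainType) n (X : 'M[R]_n) (t : R) :
  (forall i j, 0 <= X i j) -> (forall i, \sum_j X i j = t) ->
  (forall j, \sum_i X i j = t) ->
  exists w : 'S_n -> R,
    (forall s, 0 <= w s) /\ X = \sum_s w s *: perm_mx s.
Proof.
(* Induction on the number of nonzero entries. *)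
have [k] := ubnP #|[set p : 'I_n * 'I_n | X p.1 p.2 != 0]%SET|.
elim: k X t => // k IHk X t /ltnSE leXk X0 rowX colX.
have [n0|n_gt0] := posnP n.
  subst n; exists (fun=> 0); split=> //.
  by rewrite [X]flatmx0 [RHS]flatmx0.
have [t_le0|t0] := leP t 0.
  exists (fun=> 0); split=> //; rewrite big1 => [|s _]; last exact: scale0r.
  apply/matrixP => i j; rewrite mxE; apply/eqP; rewrite eq_le X0 andbT.
  by apply: le_trans t_le0; rewrite -(rowX i) (bigD1 j) //= lerDl sumr_ge0.
have [s Xs] := perm_in_support X0 rowX colX t0.
(* With [m] the smallest entry along [s], subtracting [m *: perm_mx s] keeps the entries nonnegative
   and kills the one at [(i0, s i0)]. *)
case: (arg_minP (fun i => X i (s i)) (erefl true : predT (Ordinal n_gt0))).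
move=> i0 _ min_i0; set m := X i0 (s i0) in min_i0.
pose X' := X - m *: perm_mx s.
have X'E i j : X' i j = X i j - m * (s i == j)%:R.
  by rewrite !(perm_mx_entry, mxE).
have [||||w [w0 wX']] := IHk X' (t - m).
- apply: leq_trans leXk; apply: proper_card; apply/properP; split.
    apply/fintype.subsetP => -[i j]; rewrite !inE /= X'E.
    apply: contra => /eqP Xij; case: (s i =P j) => [sij|_]; last first.
      by rewrite Xij mulr0n mulr0 subrr.
    by have := Xs i; rewrite sij Xij ltxx.
  exists (i0, s i0); first by rewrite inE gt_eqF.
  by rewrite inE /= X'E eqxx mulr1 subrr eqxx.
- move=> i j; rewrite X'E; case: eqP => [<-|_].
    by rewrite mulr1 subr_ge0 min_i0.
  by rewrite mulr0 subr0.
- move=> i; under eq_bigr do rewrite 3!mxE.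
  by rewrite sumrB rowX -mulr_sumr perm_mx_row_sum mulr1.
- move=> j; under eq_bigr do rewrite 3!mxE.
  by rewrite sumrB colX -mulr_sumr perm_mx_col_sum mulr1.
exists (fun u => w u + m *+ (u == s)); split=> [u|].
  by rewrite addr_ge0 ?mulrn_wge0 // ltW // Xs.
under eq_bigr do rewrite scalerDl.
rewrite big_split /= -wX' (bigD1 s) //= eqxx mulr1n big1 ?addr0 ?subrK //.
by move=> u /negPf ->; rewrite mulr0n scale0r.
Qed.

(** * Entropy estimates *)

Lemma ln_le_subr1 (R : realType) (x : R) : 0 < x -> ln x <= x - 1.
Proof.
by move=> x0; have := @le_ln1Dx R (x - 1); rewrite subrKC; apply; lra.
Qed.

(** The right-hand side is the tangent at [c] of the concave function [x * ln x^-1]. *)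
Lemma mulr_lnV_le (R : realType) (x c : R) :
  0 <= x -> 0 < c -> x * ln x^-1 <= x * ln c^-1 + c - x.
Proof.
move=> x0 c0; have [->|xn0] := eqVneq x 0; first by rewrite !mul0r; lra.
have {x0 xn0} x0 : 0 < x by rewrite lt_neqAle eq_sym xn0.
have : x * ln (c / x) <= x * (c / x - 1).
  by rewrite ler_pM2l // ln_le_subr1 // divr_gt0.
rewrite mulrBr [x * (c / x)]mulrC mulfVK ?gt_eqF // ln_div ?posrE //.
by rewrite !lnV ?posrE //; lra.
Qed.

Lemma mulr_lnV_subadd (R : realType) (a b : R) :
  0 <= a -> 0 <= b ->
  (a + b) * ln (a + b)^-1 <= a * ln a^-1 + b * ln b^-1.
Proof.
move=> a0 b0; have [->|an0] := eqVneq a 0; first by rewrite !(add0r, mul0r).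
have [->|bn0] := eqVneq b 0; first by rewrite !(addr0, mul0r).
have {a0 an0} a0 : 0 < a by rewrite lt_neqAle eq_sym an0.
have {b0 bn0} b0 : 0 < b by rewrite lt_neqAle eq_sym bn0.
have ab0 : 0 < a + b by lra.
by rewrite mulrDl lerD // ler_pM2l // ler_ln ?posrE ?invr_gt0 //;
  rewrite lef_pV2 ?posrE //; lra.
Qed.

(** The tangent at [a + p] gives the bound up to the term [p * ln (a + p)^-1], which is nonnegative
    because [a + p <= 1]. *)
Lemma mulr_lnV_incr (R : realType) (a p : R) :
  0 <= a -> 0 <= p -> a + p <= 1 ->
  a * ln a^-1 <= (a + p) * ln (a + p)^-1 + p.
Proof.
move=> a0 p0 ap1; have [ap0|apn0] := eqVneq (a + p) 0.
  have -> : a = 0 by lra.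
  have -> : p = 0 by lra.
  by rewrite !addr0.
have {apn0} ap0 : 0 < a + p by rewrite lt_neqAle eq_sym apn0 addr_ge0.
have := mulr_lnV_le a0 ap0.
have : 0 <= p * ln (a + p)^-1 by rewrite mulr_ge0 // ln_ge0 // invf_ge1.
by rewrite mulrDl; lra.
Qed.

(** Entrywise entropy loss when [b] is replaced by [p]; the tangent point [c] for the [b] term stays
    free so that one value can serve all entries. *)
Lemma mulr_lnV_exchange (R : realType) (a b c p : R) :
  0 <= a -> 0 <= b -> 0 <= p -> a + p <= 1 -> 0 < c ->
  (a + b) * ln (a + b)^-1 - (a + p) * ln (a + p)^-1 <= b * ln c^-1 + c - b + p.
Proof.
move=> a0 b0 p0 ap1 c0.
have := mulr_lnV_subadd a0 b0; have := mulr_lnV_incr a0 p0 ap1.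
by have := mulr_lnV_le b0 c0; lra.
Qed.

Lemma entropy_exchange (R : realType) n (A B P : 'M[R]_n) (lam : R) :
  (forall i j, 0 <= A i j) -> (forall i j, 0 <= B i j) ->
  (forall i j, 0 <= P i j) -> (forall i j, (A + P) i j <= 1) ->
  \sum_i \sum_j B i j = n%:R * lam -> \sum_i \sum_j P i j = n%:R * lam ->
  0 < lam ->
  entropy (A + B) - entropy (A + P) <= n%:R * lam * (ln (n%:R / lam) + 1).
Proof.
move=> A0 B0 P0 AP1 sumB sumP lam0.
have [n0|n_gt0] := posnP n.
  by subst n; rewrite /entropy !big_ord0 !mul0r subr0.
have N0 : 0 < n%:R :> R by rewrite ltr0n.
(* The average entry of [B]. With this choice the sums of [c] and of [B i j] cancel, and the sum of
   [P i j] yields the [+ 1]. *)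
pose c := lam / n%:R.
have c0 : 0 < c by rewrite divr_gt0.
have -> : n%:R * lam * (ln (n%:R / lam) + 1) =
    \sum_i \sum_j (B i j * ln c^-1 + c - B i j + P i j).
  under eq_bigr do
    rewrite big_split sumrB big_split /= -mulr_suml sumr_const card_ord.
  rewrite big_split sumrB big_split /= -mulr_suml sumr_const card_ord sumB sumP.
  have natM (y : R) : y *+ n = y * n%:R by rewrite mulr_natr.
  rewrite /c invf_div; move: (n%:R : R) natM N0 => N natM N0.
  by rewrite !natM; field; lra.
rewrite /entropy -sumrB; apply: ler_sum => i _; rewrite -sumrB.
apply: ler_sum => j _; have := AP1 i j; rewrite !mxE => APij.
exact: mulr_lnV_exchange.
Qed.

(** Used with [x] = n, [k] = eta / n and [D] the mean excess cost of the suboptimal part. From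
    [lam <= x * expR (1 - k * D)] and [D <= expR (D - 1)] one gets
    [lam * D <= x * expR (- (k - 1) * D)], and [D >= 1] finishes. *)
Lemma mass_mul_gap_le (R : realType) (x lam D k eps : R) :
  0 < x -> 0 < lam -> 1 <= D ->
  0 < eps -> 1 <= k -> 1 + ln (x / eps) <= k -> k * D <= ln (x / lam) + 1 ->
  lam * D <= eps.
Proof.
move=> x0 lam0 D1 eps0 k1 kL kD.
have -> : eps = x * expR (- ln (x / eps)).
  rewrite -lnV ?posrE ?divr_gt0 // lnK ?posrE ?invr_gt0 ?divr_gt0 //.
  by field; lra.
have -> : lam = x * expR (- ln (x / lam)).
  rewrite -lnV ?posrE ?divr_gt0 // lnK ?posrE ?invr_gt0 ?divr_gt0 //.
  by field; lra.
rewrite -mulrA ler_pM2l //.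
have DE : D <= expR (D - 1) by have := expR_ge1Dx (D - 1); lra.
apply: le_trans (_ : expR (- ln (x / lam)) * expR (D - 1) <= _).
  by rewrite ler_pM2l ?expR_gt0.
by rewrite -expRD ler_expR; nra.
Qed.

(** * The Birkhoff polytope and the linear cost *)

Lemma BirkhoffP (R : realType) n (X : 'M[R]_n) :
  Birkhoff R n X <-> [/\ forall i, \sum_j X i j = 1,
    forall j, \sum_i X i j = 1 & forall i j, 0 <= X i j].
Proof.
have sumE (Y : 'M[R]_n) : Y *m const_mx 1 = const_mx 1 :> 'cV[R]_n <->
    forall i, \sum_j Y i j = 1.
  split=> [/matrixP YE i | YE].
    have := YE i 0; rewrite !mxE => <-.
    by apply: eq_bigr => j _; rewrite mxE mulr1.
  apply/matrixP => i j; rewrite !mxE -[RHS](YE i).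
  by apply: eq_bigr => l _; rewrite mxE mulr1.
have sumTE j : \sum_i X^T j i = \sum_i X i j.
  by apply: eq_bigr => i _; rewrite mxE.
rewrite /Birkhoff /=; split=> -[/sumE rowX colX X0]; split=> //.
  by move=> j; rewrite -sumTE; apply: (iffLR (sumE _)).
by apply/sumE => j; rewrite sumTE.
Qed.

Lemma costD (R : realType) n (C : 'M[nat]_n) (X Y : 'M[R]_n) :
  cost C (X + Y) = cost C X + cost C Y.
Proof.
rewrite /cost -big_split; apply: eq_bigr => i _; rewrite -big_split.
by apply: eq_bigr => j _; rewrite mxE mulrDr.
Qed.

Lemma costZ (R : realType) n (C : 'M[nat]_n) (a : R) (X : 'M[R]_n) :
  cost C (a *: X) = a * cost C X.
Proof.
rewrite /cost mulr_sumr; apply: eq_bigr => i _; rewrite mulr_sumr.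
by apply: eq_bigr => j _; rewrite mxE mulrCA.
Qed.

Lemma cost_perm_mx (R : realType) n (C : 'M[nat]_n) (s : 'S_n) :
  cost C (perm_mx s : 'M[R]_n) = (\sum_i C i (s i))%:R.
Proof.
rewrite /cost natr_sum; apply: eq_bigr => i _.
rewrite (bigD1 (s i)) //= perm_mx_entry eqxx mulr1 big1 ?addr0 // => j ne.
by rewrite perm_mx_entry eq_sym (negPf ne) mulr0.
Qed.

Lemma cost_sum_perm_mx (R : realType) n (C : 'M[nat]_n) (w : 'S_n -> R)
    (Q : pred 'S_n) :
  cost C (\sum_(s | Q s) w s *: perm_mx s) =
  \sum_(s | Q s) w s * (\sum_i C i (s i))%:R.
Proof.
apply: (big_ind2 (fun X y => cost C X = y)) => [|X x Y y <- <-|s _].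
- by rewrite -(scale0r 0) costZ mul0r.
- exact: costD.
- by rewrite costZ cost_perm_mx.
Qed.

Lemma row_sum_perm_mx (R : realType) n (w : 'S_n -> R) (Q : pred 'S_n) i :
  \sum_j (\sum_(s | Q s) w s *: perm_mx s : 'M[R]_n) i j = \sum_(s | Q s) w s.
Proof.
under eq_bigr do rewrite summxE.
rewrite exchange_big; apply: eq_bigr => s _ /=.
under eq_bigr do rewrite mxE.
by rewrite -mulr_sumr perm_mx_row_sum mulr1.
Qed.

Lemma col_sum_perm_mx (R : realType) n (w : 'S_n -> R) (Q : pred 'S_n) j :
  \sum_i (\sum_(s | Q s) w s *: perm_mx s : 'M[R]_n) i j = \sum_(s | Q s) w s.
Proof.
under eq_bigr do rewrite summxE.
rewrite exchange_big; apply: eq_bigr => s _ /=.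
under eq_bigr do rewrite mxE.
by rewrite -mulr_sumr perm_mx_col_sum mulr1.
Qed.

Lemma Birkhoff_convex_perm_mx (R : realType) n (X : 'M[R]_n) :
  (0 < n)%N -> Birkhoff R n X ->
  exists w : 'S_n -> R,
    [/\ forall s, 0 <= w s, \sum_s w s = 1 & X = \sum_s w s *: perm_mx s].
Proof.
move=> n_gt0 /BirkhoffP[rowX colX X0].
have [w [w0 XE]] := perm_mx_decomposition X0 rowX colX.
exists w; split=> //.
(* The total weight is read off as the sum of the first row, which exists since [0 < n]. *)
by rewrite -(row_sum_perm_mx w xpredT (Ordinal n_gt0)) -XE.
Qed.

(** The cost of a doubly stochastic matrix is a weighted mean of permutation costs. *)
Lemma min_perm_cost_le_assignment_value (R : realType) n (C : 'M[nat]_n)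
    (m : nat) :
  (0 < n)%N -> (forall s : 'S_n, (m <= \sum_i C i (s i))%N) ->
  m%:R <= assignment_value R C.
Proof.
move=> n_gt0 m_le; apply: lb_le_inf.
  (* A lower bound passes to [inf] only for a nonempty set; the identity matrix is a member. *)
  exists (cost C 1%:M); exists 1%:M => //; rewrite -perm_mx1.
  apply/BirkhoffP; split=> [i|j|i j]; first exact: perm_mx_row_sum.
    exact: perm_mx_col_sum.
  by rewrite perm_mx_entry ler0n.
move=> _ [X BX <-]; have [w [w0 w1 ->]] := Birkhoff_convex_perm_mx n_gt0 BX.
have -> : m%:R = \sum_s w s * m%:R :> R by rewrite -mulr_suml w1 mul1r.
rewrite cost_sum_perm_mx.
by apply: ler_sum => s _; apply: ler_wpM2l => //; rewrite ler_nat.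
Qed.

(** * The approximation bound *)

Theorem proposition5 (R : realType) :
  exists K : R, 0 < K /\
    forall (n : nat) (C : 'M[nat]_n) (eps : R),
      (exists X Y : 'M[R]_n,
         [/\ Birkhoff R n X, Birkhoff R n Y & cost C X <> cost C Y]) ->
      0 < eps ->
      let eta := K * (n%:R * Num.max 1 (ln (n%:R / eps))) in
      forall Xeta : 'M[R]_n,
        is_minimizer (Birkhoff R n) (penalized_cost C eta) Xeta ->
        cost C Xeta - assignment_value R C <= eps.
Proof.
exists 2; split=> // n C eps [X1 [X2 [_ _ neX]]] eps0 eta X [BX minX].
have [n0|n_gt0] := posnP n.
  (* For n = 0 every cost is 0, against the assumption that the cost is not constant. *)
  by subst n; case: neX; rewrite /cost !big_ord0.
have N0 : 0 < n%:R :> R by rewrite ltr0n.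
(* [k] is eta / n. The maximum dominates both 1 and the logarithm, so its double dominates their
   sum, as [mass_mul_gap_le] requires. *)
set k := 2 * Num.max 1 (ln (n%:R / eps)).
have etaE : eta = n%:R * k by rewrite /eta /k mulrCA.
have max1 : 1 <= Num.max 1 (ln (n%:R / eps)) by rewrite le_max lexx.
have maxL : ln (n%:R / eps) <= Num.max 1 (ln (n%:R / eps)).
  by rewrite le_max lexx orbT.
have k1 : 1 <= k by rewrite /k; lra.
have kL : 1 + ln (n%:R / eps) <= k by rewrite /k; lra.
have eta0 : 0 < eta by rewrite etaE mulr_gt0 //; lra.
pose c (s : 'S_n) := (\sum_i C i (s i))%N.
case: (arg_minnP c (erefl true : predT (1%g : 'S_n))) => s0 _ min_s0.
have le_val : (c s0)%:R <= assignment_value R C.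
  by apply: min_perm_cost_le_assignment_value => // s; exact: min_s0.
have [w [w0 w1 XE]] := Birkhoff_convex_perm_mx n_gt0 BX.
pose opt s := c s == c s0.
pose A : 'M[R]_n := \sum_(s | opt s) w s *: perm_mx s.
pose B : 'M[R]_n := \sum_(s | ~~ opt s) w s *: perm_mx s.
pose lam := \sum_(s | ~~ opt s) w s.
pose P : 'M[R]_n := lam *: perm_mx s0.
have XAB : X = A + B by rewrite XE (bigID opt).
have wA : \sum_(s | opt s) w s = 1 - lam.
  by rewrite -w1 [in RHS](bigID opt) /= addrK.
have lam_ge0 : 0 <= lam by apply: sumr_ge0.
have Q0 (Q : pred 'S_n) i j : 0 <= (\sum_(s | Q s) w s *: perm_mx s) i j.
  rewrite summxE sumr_ge0 // => s _.
  by rewrite mxE perm_mx_entry mulr_ge0.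
have P0 i j : 0 <= P i j by rewrite mxE perm_mx_entry mulr_ge0.
have costA : cost C A = (1 - lam) * (c s0)%:R.
  rewrite cost_sum_perm_mx -wA mulr_suml.
  by apply: eq_bigr => s /eqP sE; congr (_ * _%:R); exact: sE.
have costP : cost C P = lam * (c s0)%:R by rewrite costZ cost_perm_mx.
have rowP i : \sum_j P i j = lam.
  under eq_bigr do rewrite mxE.
  by rewrite -mulr_sumr perm_mx_row_sum mulr1.
have BAP : Birkhoff R n (A + P).
  apply/BirkhoffP; split=> [i|j|i j].
  - under eq_bigr do rewrite mxE.
    by rewrite big_split /= row_sum_perm_mx rowP wA subrK.
  - under eq_bigr do rewrite 2!mxE.
    rewrite big_split /= col_sum_perm_mx -mulr_sumr perm_mx_col_sum.
    by rewrite wA mulr1 subrK.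
  - by rewrite mxE addr_ge0 ?Q0.
have AP1 i j : (A + P) i j <= 1.
  have /BirkhoffP[rowAP _ AP0] := BAP.
  by rewrite -(rowAP i) (bigD1 j) //= lerDl sumr_ge0.
have gapE : cost C X - (c s0)%:R = cost C B - lam * (c s0)%:R.
  by rewrite XAB costD costA; ring.
(* The optimal part [A] cancels: the gap is at most the excess of [B] over the same mass placed on
   [s0]. *)
apply: le_trans (_ : cost C B - lam * (c s0)%:R <= _).
  by rewrite -gapE lerD2l lerN2.
(* If [lam] is 0, all suboptimal weights vanish and so does the gap; otherwise division by [lam] is
   allowed. *)
have [lam0|lam_neq0] := eqVneq lam 0.
  suff -> : cost C B = 0 by rewrite lam0; lra.
  rewrite cost_sum_perm_mx big1 // => s sn.
  have -> : w s = 0.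
    apply/eqP; rewrite eq_le w0 andbT -lam0 /lam (bigD1 s) //= lerDl.
    exact: sumr_ge0.
  exact: mul0r.
have lam_gt0 : 0 < lam by rewrite lt_neqAle eq_sym lam_neq0.
(* Integrality: a suboptimal permutation costs at least 1 more than [s0]. *)
have gap_ge : lam <= cost C B - lam * (c s0)%:R.
  rewrite cost_sum_perm_mx /lam mulr_suml -sumrB; apply: ler_sum => s sn.
  rewrite -mulrBr; apply: ler_peMr => //; rewrite lerBrDr addrC natr1 ler_nat.
  by rewrite ltn_neqAle eq_sym sn; exact: min_s0.
have := minX _ BAP.
rewrite /penalized_cost XAB !costD costP => opt_cmp.
have rowsum (Y : 'M[R]_n) : (forall i, \sum_j Y i j = lam) ->
    \sum_i \sum_j Y i j = n%:R * lam.
  move=> YE; under eq_bigr do rewrite YE.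
  by rewrite sumr_const card_ord mulr_natl.
have ent := entropy_exchange (Q0 _) (Q0 _) P0 AP1
  (rowsum B (row_sum_perm_mx _ _)) (rowsum P rowP) lam_gt0.
set G := cost C B - _ in gap_ge *.
(* Minimality of [X] against [A + P] bounds [eta * G] by the entropy difference. *)
have eta_gap : eta * G <= n%:R * lam * (ln (n%:R / lam) + 1).
  apply: le_trans ent; rewrite mulrC -ler_pdivlMr // mulrC mulrBr /G.
  by rewrite -/A -/B; lra.
(* [G / lam] is the mean excess [D], at least 1 by [gap_ge]. *)
have -> : G = lam * (G / lam) by rewrite mulrC divfK.
apply: mass_mul_gap_le k1 kL _ => //.
  by rewrite ler_pdivlMr // mul1r.
rewrite -(ler_pM2l (mulr_gt0 N0 lam_gt0)); apply: le_trans eta_gap.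
by rewrite etaE le_eqVlt; apply/orP; left; apply/eqP; field.
Qed.
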